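(* Let $T=3$, $L=\ell=1$, and suppose $\underline{C}\le\overline{V}<\underline{C}+V$, $\overline{C}-\overline{V}-V\ge 0$ and $\overline{C}-\underline{C}-2V\ge 0$. Then $\mathrm{conv}(P)$ is the set of all $(x,y,u)=(x_1,x_2,x_3,y_1,y_2,y_3,u_2,u_3)\in\mathbb{R}^8$ satisfying \begin{align*} & u_2\ge y_2-y_1,\quad u_3\ge y_3-y_2,\quad u_2\ge 0,\quad u_3\ge 0,\\ & x_1\ge\underline{C}y_1,\quad x_2\ge\underline{C}y_2,\quad x_3\ge\underline{C}y_3,\\ & u_2\le y_2,\quad u_3\le y_3,\quad y_1+u_2\le 1,\quad y_2+u_3\le 1,\\ & x_1\le\overline{V}y_1+(\overline{C}-\overline{V})(y_2-u_2),\\ & x_1\le\overline{V}y_1+V(y_2-u_2)+(\overline{C}-\overline{V}-V)(y_3-u_3),\\ & x_2\le\overline{C}y_2-(\overline{C}-\overline{V})u_2,\\ & x_2\le\overline{V}y_2+(\overline{C}-\overline{V})(y_3-u_3),\\ & x_3\le\overline{C}y_3-(\overline{C}-\overline{V})u_3,\\ & x_3\le(\overline{V}+V)y_3-Vu_3+(\overline{C}-\overline{V}-V)(y_2-u_2),\\ & x_2-x_1\le\overline{V}y_2-\underline{C}y_1+(\underline{C}+V-\overline{V})(y_3-u_3),\\ & x_2-x_1\le(\underline{C}+V)y_2-\underline{C}y_1-(\underline{C}+V-\overline{V})u_2,\\ & x_3-x_2\le(\underline{C}+V)y_3-\underline{C}y_2-(\underline{C}+V-\overline{V})u_3,\\ &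 x_1-x_2\le\overline{V}y_1-(\overline{V}-V)y_2-(\underline{C}+V-\overline{V})u_2,\\ & x_2-x_3\le\overline{V}y_2-(\overline{V}-V)y_3-(\underline{C}+V-\overline{V})u_3,\\ & x_2-x_3\le(\underline{C}+V)y_2-\underline{C}y_3-(\underline{C}+V-\overline{V})u_2,\\ & x_3-x_1\le(\underline{C}+2V)y_3-\underline{C}y_1-(\underline{C}+2V-\overline{V})u_3,\\ & x_3-x_1\le(\overline{V}+V)y_3-Vu_3-\underline{C}y_1+(\underline{C}+V-\overline{V})(y_2-u_2),\\ & x_1-x_3\le\overline{V}y_1-\underline{C}y_3+(\underline{C}+2V-\overline{V})(y_2-u_2),\\ & x_1-x_3\le\overline{V}y_1-\underline{C}y_3+V(y_2-u_2)+(\underline{C}+V-\overline{V})(y_3-u_3). \end{align*}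
   Context: $T$ is the number of time periods, $L,\ell$ are positive integers (minimum-up and minimum-down time), and $\underline{C},\overline{C},\overline{V},V$ are real parameters (generation lower bound, generation upper bound, start-up/shut-down ramp rate, ramp rate in the stable region) with $0\le\underline{C}\le\overline{V}\le\overline{C}$ and $V>0$. For integers $a,b$, $[a,b]_{\mathbb{Z}}$ is the set of integers $i$ with $a\le i\le b$. $P$ is the set of $(x,y,u)\in\mathbb{R}_+^T\times\{0,1\}^T\times\{0,1\}^{T-1}$, with $x=(x_1,\dots,x_T)$, $y=(y_1,\dots,y_T)$, $u=(u_2,\dots,u_T)$, such that \begin{align*} &\textstyle\sum_{i=t-L+1}^{t}u_i\le y_t,\ t\in[L+1,T]_{\mathbb{Z}};\qquad \sum_{i=t-\ell+1}^{t}u_i\le 1-y_{t-\ell},\ t\in[\ell+1,T]_{\mathbb{Z}};\\ &y_t-y_{t-1}-u_t\le 0,\ t\in[2,T]_{\mathbb{Z}};\qquad \underline{C}y_t\le x_t\le\overline{C}y_t,\ t\in[1,T]_{\mathbb{Z}};\\ &x_t-x_{t-1}\le Vy_{t-1}+\overline{V}(1-y_{t-1}),\ t\in[2,T]_{\mathbb{Z}};\qquad x_{t-1}-x_t\le Vy_t+\overline{V}(1-y_t),\ t\in[2,T]_{\mathbb{Z}}. \end{align*} $\mathrm{conv}(P)$ denotes the convex hull of $P$. *)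

(* Defs.v *)
From HB Require Import structures.
From mathcomp Require Import all_boot all_order all_algebra.
From mathcomp Require Import all_classical all_reals all_analysis.

Set Implicit Arguments.
Unset Strict Implicit.
Unset Printing Implicit Defensive.

Import Order.TTheory GRing.Theory Num.Theory.

Local Open Scope classical_set_scope.
Local Open Scope ring_scope.

(* The space R^T x R^T x R^(T-1) of triples (x, y, u). *)
Definition uc_space (R : realType) (T : nat) : lmodType R :=
  ('rV[R]_T * 'rV[R]_T * 'rV[R]_(T.-1))%type.

(* The entry of v with label t, where the entries of v are labelled
   s, s + 1, ..., s + n - 1.  Only meaningful for labels in that range: it is 0
   above it, and truncated subtraction sends every t < s to the first entry. *)
Definition entry (R : realType) (n s : nat) (v : 'rV[R]_n) (t : nat) : R :=
  if insub (t - s)%N is Some i then v ord0 i else 0.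

(* x and y are labelled 1, ..., T, whereas u is labelled 2, ..., T. *)
Definition xcoord (R : realType) (T : nat) (p : uc_space R T) (t : nat) : R :=
  entry 1 p.1.1 t.

Definition ycoord (R : realType) (T : nat) (p : uc_space R T) (t : nat) : R :=
  entry 1 p.1.2 t.

Definition ucoord (R : realType) (T : nat) (p : uc_space R T) (t : nat) : R :=
  entry 2 p.2 t.

(* L = minimum-up time, l = minimum-down time, Cmin and Cmax = generation
   bounds, Vbar = start-up/shut-down ramp rate, V = stable ramp rate.  The sums
   over t - L + 1 <= i <= t have lower index (t - L).+1, with t - L not
   truncated since t >= L + 1. *)
Definition P (R : realType) (T L l : nat) (Cmin Cmax Vbar V : R) :
    set (uc_space R T) :=
  [set p | let x := xcoord p in let y := ycoord p in let u := ucoord p in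
    (forall t, (1 <= t <= T)%N -> 0 <= x t) /\
    (forall t, (1 <= t <= T)%N -> y t = 0 \/ y t = 1) /\
    (forall t, (2 <= t <= T)%N -> u t = 0 \/ u t = 1) /\
    (forall t, (L + 1 <= t <= T)%N ->
       \sum_((t - L).+1 <= i < t.+1) u i <= y t) /\
    (forall t, (l + 1 <= t <= T)%N ->
       \sum_((t - l).+1 <= i < t.+1) u i <= 1 - y (t - l)%N) /\
    (forall t, (2 <= t <= T)%N -> y t - y (t - 1)%N - u t <= 0) /\
    (forall t, (1 <= t <= T)%N -> Cmin * y t <= x t /\ x t <= Cmax * y t) /\
    (forall t, (2 <= t <= T)%N ->
       x t - x (t - 1)%N <= V * y (t - 1)%N + Vbar * (1 - y (t - 1)%N)) /\
    (forall t, (2 <= t <= T)%N ->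
       x (t - 1)%N - x t <= V * y t + Vbar * (1 - y t))].

Definition convex_hull (R : realType) (E : lmodType R) (A : set E) : set E :=
  \bigcap_(C in [set C : set E | convex_set C /\ A `<=` C]) C.

(* Main.v *)
(* A vertex (y, u) of the 0/1 part is determined by y, so conv(P) is a
   disjunctive hull over the eight vectors y.  Shift x_t by Cmin y_t and put
   v = Vbar - Cmin, M = Cmax - Cmin, p = y2 - u2 (the weight of y1 = y2 = 1)
   and q = y3 - u3 (the weight of y2 = y3 = 1).  A point of P with y = 110
   plus one with y = 011 can be exchanged for one with y = 111 plus one with
   y = 010, so the weight of 111 may be taken to be min(p, q).  If p <= q (the
   other case follows by time reversal) the vector 110 disappears, and what is
   left to choose is h, the share of x2 carried by 111, and k, h plus the share
   of x2 carried by 011.  They are subject to bounds on h, k and k - h only, and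
   Fourier-Motzkin elimination of h and k yields inequalities that follow from
   those of the theorem. *)

Require Import Defs.
From HB Require Import structures.
From mathcomp Require Import all_boot all_order all_algebra.
From mathcomp Require Import all_classical all_reals all_analysis.
From mathcomp Require Import ring lra.

Set Implicit Arguments.
Unset Strict Implicit.
Unset Printing Implicit Defensive.

Import Order.TTheory GRing.Theory Num.Theory.

Local Open Scope classical_set_scope.
Local Open Scope ring_scope.

(** * Elimination of real variables and splitting of the ramp shares *)

(** One step of Fourier-Motzkin elimination: [x] is lowered to each new upper bound and raised to
    each new lower bound. For concrete lists [allrel] computes to a conjunction within reach of
    [lra]. *)
Lemma exists_between (R : realDomainType) (lo hi : seq R) :
  allrel <=%R lo hi -> exists x, all (<= x) lo && all (>= x) hi.
Proof.
elim: lo => [_|l lo IHlo].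
  elim: hi => [|h hi [x /= xhi]]; first by exists 0.
  exists (Num.min x h); rewrite /= ge_min lexx orbT /=.
  by apply: sub_all xhi => y /= xley; rewrite ge_min xley.
rewrite allrel_consl => /andP[lhi /IHlo[x /andP[lox xhi]]].
exists (Num.max x l); rewrite /= le_max lexx orbT /=; apply/andP; split.
  by apply: sub_all lox => y /= ylex; rewrite le_max ylex.
by apply/allP => y yhi; rewrite /= ge_max (allP xhi _ yhi) (allP lhi _ yhi).
Qed.

Lemma exists_split (R : realDomainType) (a b e : R) :
  0 <= a -> 0 <= b -> 0 <= e <= a + b ->
  exists c, 0 <= c <= a /\ 0 <= e - c <= b.
Proof.
move=> a0 b0 /andP[e0 eab].
have [|c /=] := @exists_between R [:: 0; e - b] [:: a; e].
  by rewrite /allrel /= !andbT; lra.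
by move=> c_bnd; exists c; lra.
Qed.

(* A is the weight of (y1, y2) = (1, 0), B that of (y2, y3) = (0, 1), Y that of
   y2 = 1 and s that of y = 111.  The shares of x1, x2, x3 are f, g, h for
   y = 110, 011, 111, and e1, e2, e3 for (y1, y2) = (1, 0), y = 010 and
   (y2, y3) = (0, 1). *)
Definition ramp_split (R : realFieldType) (v V M A B Y p q x1 x2 x3 : R) :=
  exists s e1 e2 e3 f1 f2 g2 g3 h1 h2 h3 : R,
  [&& 0 <= s, s <= p, s <= q & p + q - s <= Y] /\
  [&& 0 <= e1 <= v * A, 0 <= e2 <= v * (Y - p - q + s) & 0 <= e3 <= v * B] /\
  [&& 0 <= f1, 0 <= f2 <= v * (p - s) & f1 - f2 <= V * (p - s)] /\
  [&& 0 <= g3, 0 <= g2 <= v * (q - s) & g3 - g2 <= V * (q - s)] /\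
  [&& 0 <= h1 <= M * s, 0 <= h2 <= M * s, 0 <= h3 <= M * s,
      h1 - h2 <= V * s, h2 - h1 <= V * s, h2 - h3 <= V * s & h3 - h2 <= V * s]
  /\ [/\ x1 = e1 + f1 + h1, x2 = e2 + f2 + g2 + h2 & x3 = e3 + g3 + h3].

(** Reversing time exchanges y = 110 with 011, fixes 010 and 111, and permutes the constraints. *)
Lemma ramp_split_rev (R : realFieldType) (v V M A B Y p q x1 x2 x3 : R) :
  ramp_split v V M A B Y p q x1 x2 x3 -> ramp_split v V M B A Y q p x3 x2 x1.
Proof.
move=> [s [e1 [e2 [e3 [f1 [f2 [g2 [g3 [h1 [h2 [h3 H]]]]]]]]]]].
exists s, e3, e2, e1, g3, g2, f2, f1, h3, h2, h1.
by case: H => ? [? [? [? [? [? ? ?]]]]]; do ![split=> //]; lra.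
Qed.

(** With [s = p] the vector 110 gets weight zero, and the remaining linear system is solved one
    variable at a time. *)
Lemma ramp_split_le (R : realFieldType) (v V M A B Y p q x1 x2 x3 : R) :
  [&& 0 <= v <= V & v + V <= M] ->
  [&& 0 <= A, 0 <= B, 0 <= p, p <= q & q <= Y] ->
  [&& 0 <= x1 <= v * A + M * p, 0 <= x2 <= v * Y + (M - v) * p,
      0 <= x3 <= v * B + M * q,
      x3 <= v * B + (v + V) * q + (M - v - V) * p,
      x2 - x1 <= v * Y + (V - v) * p, x3 - x2 <= v * B + V * q,
      x1 - x2 <= v * A + V * p, x2 - x3 <= v * Y + (V - v) * p,
      x3 - x1 <= v * B + (v + V) * q + (V - v) * p
    & x1 - x3 <= v * A + 2 * V * p] ->
  ramp_split v V M A B Y p q x1 x2 x3.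
Proof.
move=> /andP[/andP[v0 vV] vVM] /and5P[A0 B0 p0 pq qY] ineqs.
(* [lra] treats nonlinear monomials as atoms, so the signs of the products met in the eliminations
   are supplied here. *)
have pr (a b : R) : 0 <= a -> 0 <= b -> 0 <= a * b by exact: mulr_ge0.
have vA : 0 <= v * A by exact: pr.
have vB : 0 <= v * B by exact: pr.
have vp : 0 <= v * p by exact: pr.
have Vp : 0 <= (V - v) * p by apply: pr => //; lra.
have Mp : 0 <= (M - v - V) * p by apply: pr => //; lra.
have vqp : 0 <= v * (q - p) by apply: pr => //; lra.
have Vqp : 0 <= (V - v) * (q - p) by apply: pr; lra.
have Mqp : 0 <= (M - v - V) * (q - p) by apply: pr; lra.
have vYq : 0 <= v * (Y - q) by apply: pr; lra.
(* [gl] and [hl] are the lower bounds on [k - h] and [h] set by x3 and x1. *)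
set gl := x3 - v * B - V * (q - p) - M * p.
set hl := x1 - v * A - V * p.
(* Elimination goes from [g3] through [h3], [h1] and [h] to [k], so the choices go backwards. A
   bound on [k] comes from the share [x2 - k] of y = 010, from the existence of [h3], or from
   pairing a lower with an upper bound of [h]. *)
have [|k /=] := @exists_between R
  [:: 0; x3 - v * B - V * q; x2 - v * (Y - q); hl; gl; hl + gl]
  [:: x2; M * p + v * (q - p); x1 + V * p + v * (q - p);
      x3 + V * p + v * (q - p)].
  rewrite /allrel /= !andbT /gl /hl; lra.
rewrite !andbT => k_bnd.
(* [hl], [x1 + V * p], [x3 + V * p] and [k - gl] are the conditions for [h1] and [h3] to exist. *)
have [|h /=] := @exists_between R [:: 0; hl; k - v * (q - p)]
    [:: M * p; x1 + V * p; x3 + V * p; k; k - gl].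
  move: k_bnd; rewrite /allrel /= !andbT /gl /hl => k_bnd; lra.
rewrite !andbT => h_bnd.
have [|h1 /=] := @exists_between R [:: 0; h - V * p; x1 - v * A]
    [:: M * p; h + V * p; x1].
  move: k_bnd h_bnd; rewrite /allrel /= !andbT /gl /hl => k_bnd h_bnd.
  lra.
rewrite !andbT => h1_bnd.
(* The last lower bound leaves room for [g3], whose interval below must be nonempty. *)
have [|h3 /=] := @exists_between R
    [:: 0; h - V * p; x3 - v * B - (k - h) - V * (q - p)]
    [:: M * p; h + V * p; x3].
  move: k_bnd h_bnd; rewrite /allrel /= !andbT /gl /hl => k_bnd h_bnd.
  lra.
rewrite !andbT => h3_bnd.
have [|g3 /=] := @exists_between R [:: 0; x3 - h3 - v * B]
    [:: k - h + V * (q - p); x3 - h3].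
  move: k_bnd h_bnd h3_bnd; rewrite /allrel /= !andbT /gl /hl.
  by move=> k_bnd h_bnd h3_bnd; lra.
rewrite !andbT => g3_bnd.
(* Here [f1 = f2 = 0], and [e1], [e2], [e3] are the remainders of [x1], [x2], [x3]. *)
exists p, (x1 - h1), (x2 - k), (x3 - h3 - g3), 0, 0, (k - h), g3, h1, h, h3.
move: k_bnd h_bnd h1_bnd h3_bnd g3_bnd; rewrite /gl /hl.
by move=> k_bnd h_bnd h1_bnd h3_bnd g3_bnd; do ![split]; lra.
Qed.

(** * Coordinates of the space for T = 3 *)

Definition uc_point (R : realType) (x1 x2 x3 y1 y2 y3 u2 u3 : R) :
    uc_space R 3 :=
  (\row_(i < 3) [:: x1; x2; x3]`_i, \row_(i < 3) [:: y1; y2; y3]`_i,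
   \row_(i < 2) [:: u2; u3]`_i).

Lemma entryE (R : realType) (n s : nat) (v : 'rV[R]_n) (i : 'I_n) :
  entry s v (s + i)%N = v ord0 i.
Proof. by rewrite /entry addKn valK. Qed.

Section Coordinates.
Variable R : realType.
Implicit Type p : uc_space R 3.

Lemma xcoordE p (i : 'I_3) : xcoord p i.+1 = p.1.1 ord0 i.
Proof. exact: entryE. Qed.

Lemma ycoordE p (i : 'I_3) : ycoord p i.+1 = p.1.2 ord0 i.
Proof. exact: entryE. Qed.

Lemma ucoordE p (i : 'I_2) : ucoord p i.+2 = p.2 ord0 i.
Proof. exact: entryE. Qed.

Lemma coord_linear a p b q t : (1 <= t <= 3)%N ->
  xcoord (a *: p + b *: q) t = a * xcoord p t + b * xcoord q t /\
  ycoord (a *: p + b *: q) t = a * ycoord p t + b * ycoord q t.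
Proof.
case: t => // t /= lt_t3; rewrite -[t]/(val (Ordinal (lt_t3 : (t < 3)%N))).
by rewrite !xcoordE !ycoordE !mxE.
Qed.

Lemma ucoord_linear a p b q t : (2 <= t <= 3)%N ->
  ucoord (a *: p + b *: q) t = a * ucoord p t + b * ucoord q t.
Proof.
case: t => // -[//|t] /= lt_t2.
rewrite -[t]/(val (Ordinal (lt_t2 : (t < 2)%N))).
by rewrite !ucoordE !mxE.
Qed.

Lemma uc_point_eta p : p =
  uc_point (xcoord p 1) (xcoord p 2) (xcoord p 3)
           (ycoord p 1) (ycoord p 2) (ycoord p 3) (ucoord p 2) (ucoord p 3).
Proof.
case: p => -[x y] u; congr (_, _, _); apply/rowP.
- by case=> -[|[|[|//]]] i_lt; rewrite mxE /=;
     rewrite -(xcoordE (x, y, u) (Ordinal i_lt)).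
- by case=> -[|[|[|//]]] i_lt; rewrite mxE /=;
     rewrite -(ycoordE (x, y, u) (Ordinal i_lt)).
- by case=> -[|[|//]] i_lt; rewrite mxE /=;
     rewrite -(ucoordE (x, y, u) (Ordinal i_lt)).
Qed.

Lemma uc_point_coord x1 x2 x3 y1 y2 y3 u2 u3 :
  let p := uc_point x1 x2 x3 y1 y2 y3 u2 u3 : uc_space R 3 in
  [/\ [/\ xcoord p 1 = x1, xcoord p 2 = x2 & xcoord p 3 = x3],
      [/\ ycoord p 1 = y1, ycoord p 2 = y2 & ycoord p 3 = y3]
    & ucoord p 2 = u2 /\ ucoord p 3 = u3].
Proof.
have xE i := xcoordE (uc_point x1 x2 x3 y1 y2 y3 u2 u3) i.
have yE i := ycoordE (uc_point x1 x2 x3 y1 y2 y3 u2 u3) i.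
have uE i := ucoordE (uc_point x1 x2 x3 y1 y2 y3 u2 u3) i.
split; do ?split.
- by rewrite (xE (@Ordinal 3 0 isT)) mxE.
- by rewrite (xE (@Ordinal 3 1 isT)) mxE.
- by rewrite (xE (@Ordinal 3 2 isT)) mxE.
- by rewrite (yE (@Ordinal 3 0 isT)) mxE.
- by rewrite (yE (@Ordinal 3 1 isT)) mxE.
- by rewrite (yE (@Ordinal 3 2 isT)) mxE.
- by rewrite (uE (@Ordinal 2 0 isT)) mxE.
- by rewrite (uE (@Ordinal 2 1 isT)) mxE.
Qed.

Lemma eq_uc_point x1 x2 x3 y1 y2 y3 u2 u3 x1' x2' x3' y1' y2' y3' u2' u3' :
  x1 = x1' -> x2 = x2' -> x3 = x3' -> y1 = y1' -> y2 = y2' -> y3 = y3' ->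
  u2 = u2' -> u3 = u3' ->
  (uc_point x1 x2 x3 y1 y2 y3 u2 u3 : uc_space R 3) =
  uc_point x1' x2' x3' y1' y2' y3' u2' u3'.
Proof. by do 8 move=> ->. Qed.

Lemma uc_pointD x1 x2 x3 y1 y2 y3 u2 u3 x1' x2' x3' y1' y2' y3' u2' u3' :
  (uc_point x1 x2 x3 y1 y2 y3 u2 u3 : uc_space R 3) +
   uc_point x1' x2' x3' y1' y2' y3' u2' u3' =
  uc_point (x1 + x1') (x2 + x2') (x3 + x3') (y1 + y1') (y2 + y2') (y3 + y3')
    (u2 + u2') (u3 + u3').
Proof.
by congr (_, _, _); apply/rowP => -[[|[|[|//]]] i_lt]; rewrite !mxE.
Qed.

Lemma uc_pointZ a x1 x2 x3 y1 y2 y3 u2 u3 :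
  a *: (uc_point x1 x2 x3 y1 y2 y3 u2 u3 : uc_space R 3) =
  uc_point (a * x1) (a * x2) (a * x3) (a * y1) (a * y2) (a * y3)
    (a * u2) (a * u3).
Proof.
by congr (_, _, _); apply/rowP => -[[|[|[|//]]] i_lt]; rewrite !mxE.
Qed.

End Coordinates.

(** * Weighted points of a convex set *)

(* Demanding z = 0 when w = 0 lets pieces of weight zero be added freely. *)
Definition perspective (R : numDomainType) (E : lmodType R) (C : set E) (w : R)
    (z : E) :=
  0 <= w /\ exists2 a, C a & z = w *: a.

Lemma eq_perspective1 (R : numDomainType) (E : lmodType R) (C : set E) w z z' :
  perspective C w z -> w = 1 -> z = z' -> C z'.
Proof. by case=> _ [a Ca ->] -> <-; rewrite scale1r. Qed.

Lemma perspective_sub (R : numDomainType) (E : lmodType R) (C D : set E) w z :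
  C `<=` D -> perspective C w z -> perspective D w z.
Proof. by move=> CD [w0 [a Ca za]]; split=> //; exists a; first exact: CD. Qed.

(** The pairs [(w, z)] form the convex cone over [C]: if the total weight is positive, the sum is
    that weight times the average of [a] and [a'] with coefficient [w / (w + w')]. *)
Lemma perspectiveD (R : realType) (E : lmodType R) (C : set E) w w' z z' :
  convex_set C -> perspective C w z -> perspective C w' z' ->
  perspective C (w + w') (z + z').
Proof.
move=> Cconv [w0 [a Ca ->]] [w'0 [a' Ca' ->]]; split; first exact: addr_ge0.
have [ww'0|ww'0] := eqVneq (w + w') 0.
  exists a => //.
  have -> : w = 0 by lra.
  have -> : w' = 0 by lra.
  by rewrite addr0 !scale0r addr0.
have t01 : 0 <= w / (w + w') <= 1.
  rewrite divr_ge0 ?addr_ge0 //= ler_pdivrMr; last by rewrite lt0r ww'0 addr_ge0.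
  by rewrite mul1r lerDl.
have := Cconv a a' (Itv01 (proj1 (andP t01)) (proj2 (andP t01))).
rewrite !inE => /(_ Ca Ca') Cavg.
exists (w / (w + w') *: a + (1 - w / (w + w')) *: a'); first exact: Cavg.
by rewrite scalerDr !scalerA; congr (_ *: _ + _ *: _); field.
Qed.

(** * Validity of the inequalities on P *)

Lemma forall_label13 (Q : nat -> Prop) :
  (forall t, (1 <= t <= 3)%N -> Q t) <-> [/\ Q 1%N, Q 2%N & Q 3%N].
Proof.
by split=> [HQ | [? ? ?] [|[|[|[|t]]]] //]; split; apply: HQ.
Qed.

Lemma forall_label23 (Q : nat -> Prop) :
  (forall t, (2 <= t <= 3)%N -> Q t) <-> Q 2%N /\ Q 3%N.
Proof.
by split=> [HQ | [? ?] [|[|[|[|t]]]] //]; split; apply: HQ.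
Qed.

(** For minimum-up and minimum-down time 1, each sum over [u] has the single term [u t]. *)
Lemma P_coordE (R : realType) (Cmin Cmax Vbar V : R) (p : uc_space R 3) :
  let x := xcoord p in let y := ycoord p in let u := ucoord p in
  @P R 3 1 1 Cmin Cmax Vbar V p <->
  [/\ [/\ 0 <= x 1%N, 0 <= x 2%N & 0 <= x 3%N],
      [/\ y 1%N = 0 \/ y 1%N = 1, y 2%N = 0 \/ y 2%N = 1
        & y 3%N = 0 \/ y 3%N = 1],
      [/\ u 2%N = 0 \/ u 2%N = 1 & u 3%N = 0 \/ u 3%N = 1]
    & [/\ [/\ u 2%N <= y 2%N & u 3%N <= y 3%N],
          [/\ u 2%N <= 1 - y 1%N & u 3%N <= 1 - y 2%N],
          [/\ y 2%N - y 1%N - u 2%N <= 0 & y 3%N - y 2%N - u 3%N <= 0]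
        & [/\ [/\ Cmin * y 1%N <= x 1%N /\ x 1%N <= Cmax * y 1%N,
                  Cmin * y 2%N <= x 2%N /\ x 2%N <= Cmax * y 2%N
                & Cmin * y 3%N <= x 3%N /\ x 3%N <= Cmax * y 3%N],
              [/\ x 2%N - x 1%N <= V * y 1%N + Vbar * (1 - y 1%N)
                & x 3%N - x 2%N <= V * y 2%N + Vbar * (1 - y 2%N)]
            & [/\ x 1%N - x 2%N <= V * y 2%N + Vbar * (1 - y 2%N)
                & x 2%N - x 3%N <= V * y 3%N + Vbar * (1 - y 3%N)]]]].
Proof.
rewrite /P /=; split.
(* [/[swap]] keeps the unsplit tail on top, so the nine conjuncts arrive in reverse order. *)
- do 8 case=> /[swap]; move=> /forall_label23 H9 /forall_label23 H8.
  move=> /forall_label13 H7 /forall_label23 H6 /forall_label23 H5.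
  move=> /forall_label23 H4 /forall_label23 H3 /forall_label13 H2.
  move=> /forall_label13 H1.
  by move: H4 H5; rewrite !big_nat1.
- case=> H1 H2 H3 [H4 H5 H6 [H7 H8 H9]].
  do 8 (split; first by [apply/forall_label13 | apply/forall_label23;
    rewrite ?big_nat1]).
  exact/forall_label23.
Qed.

(** Stated on plain reals for [lra], with the order and nesting of the theorem's system, so that the
    two agree by conversion. *)
Definition uc_ineqs (R : realType) (Cmin Cmax Vbar V : R)
    (x1 x2 x3 y1 y2 y3 u2 u3 : R) :=
  (u2 >= y2 - y1) /\ (u3 >= y3 - y2) /\ (u2 >= 0) /\ (u3 >= 0) /\
  (x1 >= Cmin * y1) /\ (x2 >= Cmin * y2) /\ (x3 >= Cmin * y3) /\
  (u2 <= y2) /\ (u3 <= y3) /\ (y1 + u2 <= 1) /\ (y2 + u3 <= 1) /\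
  (x1 <= Vbar * y1 + (Cmax - Vbar) * (y2 - u2)) /\
  (x1 <= Vbar * y1 + V * (y2 - u2) + (Cmax - Vbar - V) * (y3 - u3)) /\
  (x2 <= Cmax * y2 - (Cmax - Vbar) * u2) /\
  (x2 <= Vbar * y2 + (Cmax - Vbar) * (y3 - u3)) /\
  (x3 <= Cmax * y3 - (Cmax - Vbar) * u3) /\
  (x3 <= (Vbar + V) * y3 - V * u3 + (Cmax - Vbar - V) * (y2 - u2)) /\
  (x2 - x1 <= Vbar * y2 - Cmin * y1 + (Cmin + V - Vbar) * (y3 - u3)) /\
  (x2 - x1 <= (Cmin + V) * y2 - Cmin * y1 - (Cmin + V - Vbar) * u2) /\
  (x3 - x2 <= (Cmin + V) * y3 - Cmin * y2 - (Cmin + V - Vbar) * u3) /\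
  (x1 - x2 <= Vbar * y1 - (Vbar - V) * y2 - (Cmin + V - Vbar) * u2) /\
  (x2 - x3 <= Vbar * y2 - (Vbar - V) * y3 - (Cmin + V - Vbar) * u3) /\
  (x2 - x3 <= (Cmin + V) * y2 - Cmin * y3 - (Cmin + V - Vbar) * u2) /\
  (x3 - x1 <= (Cmin + 2 * V) * y3 - Cmin * y1
              - (Cmin + 2 * V - Vbar) * u3) /\
  (x3 - x1 <= (Vbar + V) * y3 - V * u3 - Cmin * y1
              + (Cmin + V - Vbar) * (y2 - u2)) /\
  (x1 - x3 <= Vbar * y1 - Cmin * y3 + (Cmin + 2 * V - Vbar) * (y2 - u2)) /\
  (x1 - x3 <= Vbar * y1 - Cmin * y3 + V * (y2 - u2)
              + (Cmin + V - Vbar) * (y3 - u3)).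

(** Each of the 27 inequalities is affine in the eight variables, so [conv_le2] averages them one by
    one. *)
Lemma uc_ineqs_convex (R : realType) (Cmin Cmax Vbar V t : R)
    (x1 x2 x3 y1 y2 y3 u2 u3 x1' x2' x3' y1' y2' y3' u2' u3' : R) :
  let avg a a' := t * a + (1 - t) * a' in
  0 <= t <= 1 ->
  uc_ineqs Cmin Cmax Vbar V x1 x2 x3 y1 y2 y3 u2 u3 ->
  uc_ineqs Cmin Cmax Vbar V x1' x2' x3' y1' y2' y3' u2' u3' ->
  uc_ineqs Cmin Cmax Vbar V (avg x1 x1') (avg x2 x2') (avg x3 x3')
    (avg y1 y1') (avg y2 y2') (avg y3 y3') (avg u2 u2') (avg u3 u3').
Proof.
move=> avg t01; rewrite /uc_ineqs /avg.
have conv_le2 (a b c d l r : R) : a <= b -> c <= d ->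
    l = t * a + (1 - t) * c -> r = t * b + (1 - t) * d -> l <= r.
  case/andP: t01 => t0 t1 ab cd -> ->.
  by rewrite lerD // ler_wpM2l // subr_ge0.
do 26 (case=> /[swap] S H [H' S']; split;
       [by apply: (conv_le2 _ _ _ _ _ _ H H'); ring | move: S S'; clear H H']).
by move=> H H'; apply: (conv_le2 _ _ _ _ _ _ H H'); ring.
Qed.

(** In P the vector y forces u, so only eight binary patterns survive, each leaving linear
    inequalities in x. *)
Lemma P_uc_ineqs (R : realType) (Cmin Cmax Vbar V : R) (p : uc_space R 3) :
  0 <= Cmin -> Cmin <= Vbar -> Vbar <= Cmax -> 0 < V -> Vbar < Cmin + V ->
  0 <= Cmax - Vbar - V -> 0 <= Cmax - Cmin - 2 * V ->
  @P R 3 1 1 Cmin Cmax Vbar V p ->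
  uc_ineqs Cmin Cmax Vbar V (xcoord p 1) (xcoord p 2) (xcoord p 3)
    (ycoord p 1) (ycoord p 2) (ycoord p 3) (ucoord p 2) (ucoord p 3).
Proof.
move=> C0 CVb VbC V0 VbV C1 C2 /P_coordE.
move: (xcoord p 1) (xcoord p 2) (xcoord p 3) (ycoord p 1) (ycoord p 2)
  (ycoord p 3) (ucoord p 2) (ucoord p 3) => x1 x2 x3 y1 y2 y3 u2 u3.
case=> -[x10 x20 x30] [Y1 Y2 Y3] [U2 U3] [[uy2 uy3] [du2 du3] [dy2 dy3]].
case=> -[[xl1 xu1] [xl2 xu2] [xl3 xu3]] [r12 r23] [r21 r32].
rewrite /uc_ineqs.
by case: Y1 => ?; case: Y2 => ?; case: U2 => ?; try (exfalso; lra);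
   case: Y3 => ?; case: U3 => ?; try (exfalso; lra); subst; lra.
Qed.

(** * Sufficiency of the inequalities *)

(** These are the constraints of P at the binary vector [(b1, b2, b3)], scaled by [w]; [~~ b1 && b2]
    is the start-up value forced by y. *)
Lemma P_perspective (R : realType) (Cmin Cmax Vbar V : R) (b1 b2 b3 : bool)
    (w x1 x2 x3 : R) :
  0 <= Cmin -> 0 <= Vbar -> 0 <= w ->
  [&& Cmin * (w * b1%:R) <= x1 <= Cmax * (w * b1%:R),
      Cmin * (w * b2%:R) <= x2 <= Cmax * (w * b2%:R)
    & Cmin * (w * b3%:R) <= x3 <= Cmax * (w * b3%:R)] ->
  [&& x2 - x1 <= w * (V * b1%:R + Vbar * (1 - b1%:R)),
      x3 - x2 <= w * (V * b2%:R + Vbar * (1 - b2%:R)),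
      x1 - x2 <= w * (V * b2%:R + Vbar * (1 - b2%:R))
    & x2 - x3 <= w * (V * b3%:R + Vbar * (1 - b3%:R))] ->
  perspective (@P R 3 1 1 Cmin Cmax Vbar V) w
    (uc_point x1 x2 x3 (w * b1%:R) (w * b2%:R) (w * b3%:R)
       (w * (~~ b1 && b2)%:R) (w * (~~ b2 && b3)%:R)).
Proof.
move=> C0 Vb0 w0 /and3P[/andP[xl1 xu1] /andP[xl2 xu2] /andP[xl3 xu3]].
move=> /and4P[r12 r23 r21 r32]; split=> //.
have [w_eq0|w_neq0] := eqVneq w 0.
  (* At weight zero the bounds force x = 0, and the origin is a point of P. *)
  exists (uc_point 0 0 0 0 0 0 0 0).
    apply/P_coordE.
    have [[-> -> ->] [-> -> ->] [-> ->]] :=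
      @uc_point_coord R 0 0 0 0 0 0 0 0.
    by do ![split] => //; (try by left); lra.
  rewrite w_eq0 scale0r !mul0r in xl1 xu1 xl2 xu2 xl3 xu3 *.
  rewrite [uc_point x1 _ _ _ _ _ _ _](_ : _ = uc_point 0 0 0 0 0 0 0 0).
    by congr (_, _, _); apply/rowP => -[[|[|[|//]]] i_lt]; rewrite !mxE.
  by congr uc_point; lra.
have w_gt0 : 0 < w by rewrite lt0r w_neq0.
exists (uc_point (x1 / w) (x2 / w) (x3 / w) b1%:R b2%:R b3%:R
          (~~ b1 && b2)%:R (~~ b2 && b3)%:R); last first.
  by rewrite uc_pointZ; congr uc_point; rewrite mulrC divfK.
apply/P_coordE.
have [[-> -> ->] [-> -> ->] [-> ->]] := @uc_point_coord R (x1 / w) (x2 / w)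
  (x3 / w) b1%:R b2%:R b3%:R (~~ b1 && b2)%:R (~~ b2 && b3)%:R.
have bit (b : bool) : b%:R = 0 :> R \/ b%:R = 1 :> R.
  by case: b; [right | left].
have start (b b' : bool) : [/\ (~~ b && b')%:R <= b'%:R :> R,
    (~~ b && b')%:R <= 1 - b%:R :> R
  & b'%:R - b%:R - (~~ b && b')%:R <= 0 :> R].
  by case: b; case: b'; split=> /=; lra.
have x_ge0 (b : bool) (x : R) : Cmin * (w * b%:R) <= x -> 0 <= x / w.
  by move=> xl; rewrite divr_ge0 // (le_trans _ xl) // !mulr_ge0.
have [? ? ?] := start b1 b2; have [? ? ?] := start b2 b3.
do ![split=> //]; try by apply: x_ge0; eassumption.
all: by rewrite -?mulrBl ?ler_pdivlMr ?ler_pdivrMr //; lra.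
Qed.

(** Since [u2] is the weight of (y1, y2) = (0, 1), that of (1, 0) is [y1 - (y2 - u2)]. In terms of
    these weights the system is invariant under time reversal, which settles the case [q < p]. *)
Lemma uc_ineqs_ramp_split (R : realType)
    (Cmin Cmax Vbar V x1 x2 x3 y1 y2 y3 u2 u3 : R) :
  Cmin <= Vbar -> 0 < V -> Vbar < Cmin + V -> 0 <= Cmax - Vbar - V ->
  uc_ineqs Cmin Cmax Vbar V x1 x2 x3 y1 y2 y3 u2 u3 ->
  ramp_split (Vbar - Cmin) V (Cmax - Cmin) (y1 + u2 - y2) u3 y2
    (y2 - u2) (y3 - u3) (x1 - Cmin * y1) (x2 - Cmin * y2) (x3 - Cmin * y3).
Proof.
move=> CVb V0 VbV C1.
move=> [du2 [du3 [u20 [u30 [xl1 [xl2 [xl3 [uy2 [uy3 [yu1 [yu2]]]]]]]]]]].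
move=> [a1 [a2 [a3 [a4 [a5 [a6 [a7 [a8 [a9 [a10]]]]]]]]]].
move=> [a11 [a12 [a13 [a14 [a15 a16]]]]].
have [le_pq|/ltW le_qp] := lerP (y2 - u2) (y3 - u3);
  last apply: ramp_split_rev.
all: by apply: ramp_split_le; lra.
Qed.

(** The point is a sum of eight weighted points of P, one for each binary y, with weights adding up
    to 1. *)
Lemma uc_ineqs_hull (R : realType) (Cmin Cmax Vbar V : R)
    (C : set (uc_space R 3)) (x1 x2 x3 y1 y2 y3 u2 u3 : R) :
  0 <= Cmin -> Cmin <= Vbar -> 0 < V -> Vbar < Cmin + V ->
  0 <= Cmax - Vbar - V ->
  convex_set C -> @P R 3 1 1 Cmin Cmax Vbar V `<=` C ->
  uc_ineqs Cmin Cmax Vbar V x1 x2 x3 y1 y2 y3 u2 u3 ->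
  C (uc_point x1 x2 x3 y1 y2 y3 u2 u3).
Proof.
move=> C0 CVb V0 VbV C1 Cconv PC ineqs.
have [s [e1 [e2 [e3 [f1 [f2 [g2 [g3 [h1 [h2 [h3]]]]]]]]]]] :=
  uc_ineqs_ramp_split CVb V0 VbV C1 ineqs.
case=> s_bnd [e_bnd [f_bnd [g_bnd [h_bnd [x1E x2E x3E]]]]].
case: ineqs => du2 [du3 [_ [u30 [_ [_ [_ [_ [_ [yu1 [yu2 _]]]]]]]]]].
(* [r] is the weight of y = 101; 100 and 001 impose no joint constraint on x. *)
have [|r /=] := @exists_between R [:: 0; y1 + u2 + u3 - 1]
    [:: y1 + u2 - y2; u3].
  by rewrite /allrel /= !andbT; lra.
rewrite !andbT => r_bnd.
have v0 : 0 <= Vbar - Cmin by lra.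
(* [e1] is divided between y = 101 and y = 100, and then [e3] between 101 and 001. *)
have [e1' [e1'_bnd e1''_bnd]] : exists c,
    0 <= c <= (Vbar - Cmin) * r /\
    0 <= e1 - c <= (Vbar - Cmin) * (y1 + u2 - y2 - r).
  apply: exists_split; rewrite ?mulr_ge0 //; lra.
have [e3' [e3'_bnd e3''_bnd]] : exists c,
    0 <= c <= (Vbar - Cmin) * r /\ 0 <= e3 - c <= (Vbar - Cmin) * (u3 - r).
  apply: exists_split; rewrite ?mulr_ge0 //; lra.
have piece b1 b2 b3 w z1 z2 z3 w0 bnds ramps : perspective C w _ :=
  perspective_sub PC (@P_perspective R Cmin Cmax Vbar V b1 b2 b3 w z1 z2 z3
    C0 (le_trans C0 CVb) w0 bnds ramps).
have slack w : 0 <= w ->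
    [/\ 0 <= Cmin * w, 0 <= (Vbar - Cmin) * w, 0 <= V * w,
        0 <= (Cmax - Vbar - V) * w & 0 <= (Cmin + V - Vbar) * w].
  by move=> w0; split; apply: mulr_ge0 => //; lra.
(* This weight is what the other seven leave of 1; the bound [y1 + u2 + u3 - 1 <= r] makes it
   nonnegative. *)
have k000 : perspective C (1 - y1 - u2 - u3 + r)
    (uc_point
       0 0 0
       0 0 0 0 0).
  have w0 : 0 <= 1 - y1 - u2 - u3 + r by lra.
  have [S1 S2 S3 S4 S5] := slack _ w0.
  have := piece false false false (1 - y1 - u2 - u3 + r)
    0 0 0 w0.
  by rewrite /= !(mulr0, mulr1); apply; lra.
have k100 : perspective C (y1 + u2 - y2 - r)
    (uc_point
       (Cmin * (y1 + u2 - y2 - r) + (e1 - e1')) 0 0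
       (y1 + u2 - y2 - r) 0 0 0 0).
  have w0 : 0 <= y1 + u2 - y2 - r by lra.
  have [S1 S2 S3 S4 S5] := slack _ w0.
  have := piece true false false (y1 + u2 - y2 - r)
    (Cmin * (y1 + u2 - y2 - r) + (e1 - e1')) 0 0 w0.
  by rewrite /= !(mulr0, mulr1); apply; lra.
have k001 : perspective C (u3 - r)
    (uc_point
       0 0 (Cmin * (u3 - r) + (e3 - e3'))
       0 0 (u3 - r) 0 (u3 - r)).
  have w0 : 0 <= u3 - r by lra.
  have [S1 S2 S3 S4 S5] := slack _ w0.
  have := piece false false true (u3 - r)
    0 0 (Cmin * (u3 - r) + (e3 - e3')) w0.
  by rewrite /= !(mulr0, mulr1); apply; lra.
have k101 : perspective C r
    (uc_point
       (Cmin * r + e1') 0 (Cmin * r + e3')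
       r 0 r 0 r).
  have w0 : 0 <= r by lra.
  have [S1 S2 S3 S4 S5] := slack _ w0.
  have := piece true false true r
    (Cmin * r + e1') 0 (Cmin * r + e3') w0.
  by rewrite /= !(mulr0, mulr1); apply; lra.
have k010 : perspective C (u2 - (y3 - u3) + s)
    (uc_point
       0 (Cmin * (u2 - (y3 - u3) + s) + e2) 0
       0 (u2 - (y3 - u3) + s) 0 (u2 - (y3 - u3) + s) 0).
  have w0 : 0 <= u2 - (y3 - u3) + s by lra.
  have [S1 S2 S3 S4 S5] := slack _ w0.
  have := piece false true false (u2 - (y3 - u3) + s)
    0 (Cmin * (u2 - (y3 - u3) + s) + e2) 0 w0.
  by rewrite /= !(mulr0, mulr1); apply; lra.
have k110 : perspective C (y2 - u2 - s)
    (uc_point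
       (Cmin * (y2 - u2 - s) + f1) (Cmin * (y2 - u2 - s) + f2) 0
       (y2 - u2 - s) (y2 - u2 - s) 0 0 0).
  have w0 : 0 <= y2 - u2 - s by lra.
  have [S1 S2 S3 S4 S5] := slack _ w0.
  have := piece true true false (y2 - u2 - s)
    (Cmin * (y2 - u2 - s) + f1) (Cmin * (y2 - u2 - s) + f2) 0 w0.
  by rewrite /= !(mulr0, mulr1); apply; lra.
have k011 : perspective C (y3 - u3 - s)
    (uc_point
       0 (Cmin * (y3 - u3 - s) + g2) (Cmin * (y3 - u3 - s) + g3)
       0 (y3 - u3 - s) (y3 - u3 - s) (y3 - u3 - s) 0).
  have w0 : 0 <= y3 - u3 - s by lra.
  have [S1 S2 S3 S4 S5] := slack _ w0.
  have := piece false true true (y3 - u3 - s)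
    0 (Cmin * (y3 - u3 - s) + g2) (Cmin * (y3 - u3 - s) + g3) w0.
  by rewrite /= !(mulr0, mulr1); apply; lra.
have k111 : perspective C s
    (uc_point
       (Cmin * s + h1) (Cmin * s + h2) (Cmin * s + h3)
       s s s 0 0).
  have w0 : 0 <= s by lra.
  have [S1 S2 S3 S4 S5] := slack _ w0.
  have := piece true true true s
    (Cmin * s + h1) (Cmin * s + h2) (Cmin * s + h3) w0.
  by rewrite /= !(mulr0, mulr1); apply; lra.
have addK w w' z z' := @perspectiveD R _ C w w' z z' Cconv.
have := addK _ _ _ _ k000 (addK _ _ _ _ k100 (addK _ _ _ _ k001
  (addK _ _ _ _ k101 (addK _ _ _ _ k010 (addK _ _ _ _ k110
  (addK _ _ _ _ k011 k111)))))).
rewrite !uc_pointD => k; apply: (eq_perspective1 k); first by ring.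
(* The multiples of [Cmin] add up to the shifts, and the shares to the shifted x. *)
by apply: eq_uc_point; clear -x1E x2E x3E; lra.
Qed.

Theorem theorem3 (R : realType) (Cmin Cmax Vbar V : R)
    (hCmin : 0 <= Cmin) (hCminVbar : Cmin <= Vbar) (hVbarCmax : Vbar <= Cmax)
    (hV : 0 < V) (hVbar : Vbar < Cmin + V)
    (hC1 : 0 <= Cmax - Vbar - V) (hC2 : 0 <= Cmax - Cmin - 2 * V) :
  convex_hull (@P R 3 1 1 Cmin Cmax Vbar V) =
  [set p : uc_space R 3 |
    let x1 := xcoord p 1 in let x2 := xcoord p 2 in let x3 := xcoord p 3 in
    let y1 := ycoord p 1 in let y2 := ycoord p 2 in let y3 := ycoord p 3 in
    let u2 := ucoord p 2 in let u3 := ucoord p 3 in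
    (u2 >= y2 - y1) /\ (u3 >= y3 - y2) /\ (u2 >= 0) /\ (u3 >= 0) /\
    (x1 >= Cmin * y1) /\ (x2 >= Cmin * y2) /\ (x3 >= Cmin * y3) /\
    (u2 <= y2) /\ (u3 <= y3) /\ (y1 + u2 <= 1) /\ (y2 + u3 <= 1) /\
    (x1 <= Vbar * y1 + (Cmax - Vbar) * (y2 - u2)) /\
    (x1 <= Vbar * y1 + V * (y2 - u2) + (Cmax - Vbar - V) * (y3 - u3)) /\
    (x2 <= Cmax * y2 - (Cmax - Vbar) * u2) /\
    (x2 <= Vbar * y2 + (Cmax - Vbar) * (y3 - u3)) /\
    (x3 <= Cmax * y3 - (Cmax - Vbar) * u3) /\
    (x3 <= (Vbar + V) * y3 - V * u3 + (Cmax - Vbar - V) * (y2 - u2)) /\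
    (x2 - x1 <= Vbar * y2 - Cmin * y1 + (Cmin + V - Vbar) * (y3 - u3)) /\
    (x2 - x1 <= (Cmin + V) * y2 - Cmin * y1 - (Cmin + V - Vbar) * u2) /\
    (x3 - x2 <= (Cmin + V) * y3 - Cmin * y2 - (Cmin + V - Vbar) * u3) /\
    (x1 - x2 <= Vbar * y1 - (Vbar - V) * y2 - (Cmin + V - Vbar) * u2) /\
    (x2 - x3 <= Vbar * y2 - (Vbar - V) * y3 - (Cmin + V - Vbar) * u3) /\
    (x2 - x3 <= (Cmin + V) * y2 - Cmin * y3 - (Cmin + V - Vbar) * u2) /\
    (x3 - x1 <= (Cmin + 2 * V) * y3 - Cmin * y1
                - (Cmin + 2 * V - Vbar) * u3) /\
    (x3 - x1 <= (Vbar + V) * y3 - V * u3 - Cmin * y1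
                + (Cmin + V - Vbar) * (y2 - u2)) /\
    (x1 - x3 <= Vbar * y1 - Cmin * y3 + (Cmin + 2 * V - Vbar) * (y2 - u2)) /\
    (x1 - x3 <= Vbar * y1 - Cmin * y3 + V * (y2 - u2)
                + (Cmin + V - Vbar) * (y3 - u3))].
Proof.
apply/seteqP; split=> p /=.
  (* The hull lies in every convex set containing P, so the polyhedron itself is taken. *)
  move/(_ [set q | uc_ineqs Cmin Cmax Vbar V (xcoord q 1) (xcoord q 2)
    (xcoord q 3) (ycoord q 1) (ycoord q 2) (ycoord q 3) (ucoord q 2)
    (ucoord q 3)]); apply; split; last by move=> q; exact: P_uc_ineqs.
  move=> q q' t; rewrite !inE /= => qI q'I.
  have avgE : conv t (q : convex_lmodType (uc_space R 3)) q' =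
      t%:num *: q + (1 - t%:num) *: q' by [].
  have t01 : 0 <= t%:num <= 1 by rewrite ge0 le1.
  have [//|X1 Y1] := coord_linear t%:num q (1 - t%:num) q' (t := 1%N).
  have [//|X2 Y2] := coord_linear t%:num q (1 - t%:num) q' (t := 2%N).
  have [//|X3 Y3] := coord_linear t%:num q (1 - t%:num) q' (t := 3%N).
  rewrite avgE X1 X2 X3 Y1 Y2 Y3 !ucoord_linear //.
  exact: uc_ineqs_convex.
move=> pI C [Cconv PC]; rewrite (uc_point_eta p).
exact: (@uc_ineqs_hull R Cmin Cmax Vbar V).
Qed.
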